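(* The sporadic simple Mathieu group $M_{11}$ (of order $7920$) has an Ordered Generating System.
   Context: Definition. A sequence of elements $a_1,\ldots,a_n$ of a group $G$ is an Ordered Generating System of $G$ if there exist non-negative integers $m_1,\ldots,m_n$ such that every element $g\in G$ has a unique representation of the form $g=a_1^{i_1}a_2^{i_2}\cdots a_n^{i_n}$ with integers $0\le i_k\le m_k$ for every $1\le k\le n$ (i.e. the exponent tuple $(i_1,\ldots,i_n)$ in this range exists and is unique). A group is said to have an Ordered Generating System if such a finite sequence exists. *)

(* Defs.v *)
From HB Require Import structures.
From mathcomp Require Import all_boot all_fingroup.

Set Implicit Arguments.
Unset Strict Implicit.
Unset Printing Implicit Defensive.

Local Open Scope group_scope.

(* The bounds [m] force a group with such a system to be finite, so nothing is
   lost by restricting to finite groups. *)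
Definition ordered_generating_system (gT : finGroupType) (G : {group gT})
    (n : nat) (a : n.-tuple gT) : Prop :=
  (forall k : 'I_n, tnth a k \in G) /\
  exists m : n.-tuple nat,
    forall g : gT, g \in G ->
      exists! i : n.-tuple nat,
        (forall k : 'I_n, tnth i k <= tnth m k) /\
        g = \prod_(k < n) tnth a k ^+ tnth i k.

Definition has_ordered_generating_system (gT : finGroupType)
    (G : {group gT}) : Prop :=
  exists (n : nat) (a : n.-tuple gT), ordered_generating_system G a.

(* For pairwise distinct x, y1, ..., yr this is the cycle
   x |-> y1 |-> ... |-> yr |-> x, since (s * t) z = t (s z) in {perm T}. *)
Definition cycle_perm (T : finType) (x : T) (s : seq T) : {perm T} :=
  \prod_(y <- s) tperm x y.

Definition pt (k : nat) : 'I_11 := inord k.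

(* The usual generators (1,2,3,4,5,6,7,8,9,10,11) and (3,7,11,8)(4,10,5,6) of
   M_11 in its 4-transitive action on 11 points, relabelled from 0. *)
Definition M11_gen1 : 'S_11 :=
  cycle_perm (pt 0) [seq pt k | k <- iota 1 10].

Definition M11_gen2 : 'S_11 :=
  cycle_perm (pt 2) [:: pt 6; pt 10; pt 7] *
  cycle_perm (pt 3) [:: pt 9; pt 4; pt 5].

Definition M11 : {group 'S_11} := <<[set M11_gen1; M11_gen2]>>%G.

(* Main.v *)
Require Import Defs.
From mathcomp Require Import all_boot all_fingroup.

(** M_11 is sharply 4-transitive.  In the chain 1 < Q_8 < 3^2:Q_8 < M_10 < M_11
of pointwise stabilisers of {0, 1, 8, 2}, {0, 1, 8}, {0, 1}, {0} and the empty
set, each subgroup K is H * T, where H is the previous one and T is a set of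
products u^i v^j carrying the next point once to each point of its K-orbit.
Concatenating the pairs (u, v) gives an ordered generating system, with
7920 = (4 * 2) * (3 * 3) * (2 * 5) * 11. *)

Set Implicit Arguments.
Unset Strict Implicit.
Unset Printing Implicit Defensive.

Import GroupScope.

(** * Injectivity read off from lists without repetition *)

Lemma uniq_map_inj (T U : eqType) (f : T -> U) (s : seq T) :
  uniq (map f s) -> {in s &, injective f}.
Proof.
elim: s => [_ ? //|z s IHs] /= /andP[fz_notin /IHs inj_f] x y.
rewrite !inE => /predU1P[->|xs] /predU1P[->|ys] // eq_f.
- by case/negP: fz_notin; rewrite eq_f map_f.
- by case/negP: fz_notin; rewrite -eq_f map_f.
exact: inj_f.
Qed.

Lemma allpairs_uniq_inj (S T U : eqType) (f : S -> T -> U) s t x x' y y' :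
  uniq [seq f x y | x <- s, y <- t] -> x \in s -> x' \in s -> y \in t ->
  y' \in t -> f x y = f x' y' -> x = x' /\ y = y'.
Proof.
rewrite -(map_allpairs (fun p : S * T => f p.1 p.2) pair).
move=> /uniq_map_inj inj_f xs xs' yt yt' eq_f.
suff [-> ->] : (x, y) = (x', y') by [].
by apply: (inj_f (x, y) (x', y')) eq_f; apply: allpairs_f.
Qed.

(** * Ordered products of powers in a finite group *)

Section Products.

Variable gT : finGroupType.
Implicit Types (s : seq (gT * nat)) (G : {group gT}).

(* The pair (a, m) stands for the factor a ^+ i with i <= m. *)
Fixpoint products s : seq gT :=
  if s is (a, m) :: s' then
    [seq a ^+ i * g | i <- iota 0 m.+1, g <- products s']
  else [:: 1].

(** Unfolds one factor while keeping [iota 0 m.+1] folded, which simplification would break up. *)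
Lemma products_cons a m s :
  products ((a, m) :: s) = [seq a ^+ i * g | i <- iota 0 m.+1, g <- products s].
Proof. by []. Qed.

Lemma products_cat s1 s2 :
  products (s1 ++ s2) = [seq g * h | g <- products s1, h <- products s2].
Proof.
elim: s1 => [|[a m] s1 IHs].
  by rewrite /= cats0 -[LHS]map_id; apply: eq_map => g; rewrite mul1g.
rewrite cat_cons !products_cons IHs.
elim: (iota 0 m.+1) => // i r IHr.
rewrite !allpairs_cons allpairs_cat IHr map_allpairs allpairs_mapl.
by congr (_ ++ _); apply: eq_allpairs => g h; rewrite mulgA.
Qed.

Lemma products1 s : 1 \in products s.
Proof.
elim: s => [|[a m] s IHs]; first by rewrite inE.
by rewrite products_cons; apply/allpairsP; exists (0, 1); rewrite /= inE mul1g.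
Qed.

Lemma products_sub s (g : gT) :
  g \in products s -> g \in <<[set x in unzip1 s]>>.
Proof.
elim: s g => [|[a m] s IHs] g; first by rewrite inE => /eqP->.
rewrite products_cons => /allpairsP[[i h] /= [_ /IHs hs ->]].
rewrite groupM ?groupX //; first by rewrite mem_gen // !inE eqxx.
apply: (subsetP (genS _)) hs; apply/subsetP=> x.
by rewrite !inE => ->; rewrite orbT.
Qed.

Lemma mem_products s (i : (size s).-tuple nat) :
  (forall k : 'I_(size s), tnth i k <= (nth (1, 0) s k).2) ->
  \prod_(k < size s) (nth (1, 0) s k).1 ^+ tnth i k \in products s.
Proof.
elim: s i => [|[a m] s IHs] i le_i_m; first by rewrite big_ord0 inE.
case/tupleP: i le_i_m => i t le_i_m; rewrite big_ord_recl products_cons tnth0.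
apply: (allpairs_f (fun i g => a ^+ i * g)).
  by rewrite mem_iota ltnS; have := le_i_m ord0; rewrite tnth0.
under eq_bigr do rewrite tnthS.
by apply: IHs => k; have := le_i_m (lift ord0 k); rewrite tnthS.
Qed.

(** The list has one entry per exponent tuple, so the absence of repetitions makes the first
    exponent and the product of the remaining factors unique; induction treats the latter. *)
Lemma products_exponents s (g : gT) :
  uniq (products s) -> g \in products s ->
  exists! i : (size s).-tuple nat,
    (forall k : 'I_(size s), tnth i k <= (nth (1, 0) s k).2) /\
    g = \prod_(k < size s) (nth (1, 0) s k).1 ^+ tnth i k.
Proof.
elim: s g => [|[a m] s IHs] g.
  move=> _; rewrite inE => /eqP->; exists [tuple]; split.
    by split=> [[]|] //; rewrite big_ord0.
  by move=> i _; rewrite [i]tuple0.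
rewrite products_cons => uniq_as; have uniq_s : uniq (products s).
  (* The block with exponent 0 is an image of [products s], so a repetition in [products s] would
     show up there. *)
  by move: uniq_as; rewrite /= cat_uniq => /andP[/map_uniq].
case/allpairsP=> -[i h] []; rewrite mem_iota ltnS => /= le_im hs def_g.
have [t [[le_t def_h] uniq_t]] := IHs h uniq_s hs.
exists (cons_tuple i t); split.
  split=> [k|]; last first.
    rewrite big_ord_recl /= tnth0 def_g {1}def_h; congr (_ * _).
    by apply: eq_bigr => k _; rewrite tnthS.
  by case: (unliftP ord0 k) => [k'|] ->; rewrite ?tnth0 // tnthS; apply: le_t.
case/tupleP=> i' t' [le_t']; rewrite big_ord_recl /= tnth0 def_g.
under eq_bigr do rewrite tnthS.
have le_t'' (k : 'I_(size s)) : tnth t' k <= (nth (1, 0) s k).2.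
  by have := le_t' (lift ord0 k); rewrite tnthS.
have le_i' : i' <= m by have := le_t' ord0; rewrite tnth0.
case/(allpairs_uniq_inj uniq_as) => [||||-> def_h'].
- by rewrite mem_iota.
- by rewrite mem_iota.
- by [].
- exact: mem_products.
by rewrite (uniq_t t').
Qed.

Lemma products_ogs s G :
  uniq (products s) -> {subset unzip1 s <= G} -> products s =i G ->
  has_ordered_generating_system G.
Proof.
move=> uniq_s as_G sG; exists (size s), [tuple (nth (1, 0) s k).1 | k < size s].
split=> [k|].
  rewrite tnth_mktuple; apply: as_G.
  by rewrite -(nth_map _ 1) // mem_nth ?size_map.
exists [tuple (nth (1, 0) s k).2 | k < size s] => g; rewrite -sG => gs.
have [i [[le_i def_g] uniq_i]] := products_exponents uniq_s gs.
exists i; split=> [|i' [le_i' def_g']].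
  split=> [k|]; first by rewrite tnth_mktuple.
  by rewrite {1}def_g; apply: eq_bigr => k _; rewrite tnth_mktuple.
apply: uniq_i; split=> [k|]; first by have := le_i' k; rewrite tnth_mktuple.
by rewrite {1}def_g'; apply: eq_bigr => k _; rewrite tnth_mktuple.
Qed.

(* Each t * x is rewritten as g * t' with g in H, so H * T is closed under
   right multiplication by the generators x. *)
Lemma products_gen s t :
  products s =i <<[set x in unzip1 s]>> ->
  {in products t & unzip1 (s ++ t), forall g x, g * x \in products (s ++ t)} ->
  products (s ++ t) =i <<[set x in unzip1 (s ++ t)]>>.
Proof.
move=> sH closed g; apply/idP/idP => [/products_sub //|].
have closedst : {in products (s ++ t) & unzip1 (s ++ t),
    forall g x, g * x \in products (s ++ t)}.
  move=> gh x; rewrite {1}products_cat => /allpairsP[[k h] /= [ks ht ->]] xst.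
  have:= closed h x ht xst; rewrite -mulgA products_cat.
  case/allpairsP=> -[k' h'] /= [ks' ht' ->]; rewrite mulgA allpairs_f //.
  by rewrite sH groupM -?sH.
case/gen_prodgP=> n [c c_gen ->].
elim: n c c_gen => [|n IHn] c c_gen; first by rewrite big_ord0 products1.
rewrite big_ord_recr closedst //; first by apply: IHn => i; apply: c_gen.
by have := c_gen ord_max; rewrite inE.
Qed.

End Products.

(** Permutations act left factor first, so [g * h] with [g] fixing [p] sends [p] to [h p]. This
    point determines [h], and cancelling [h] determines [g]. *)
Lemma products_uniq (T : finType) (s t : seq ({perm T} * nat)) (p : T) :
  uniq (products s) -> {in unzip1 s, forall g : {perm T}, g p = p} ->
  uniq [seq (g : {perm T}) p | g <- products t] -> uniq (products (s ++ t)).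
Proof.
move=> uniq_s fix_p uniq_tp; rewrite products_cat.
have fix_s (g : {perm T}) : g \in products s -> g p = p.
  have subC : <<[set x in unzip1 s]>> \subset 'C[p | 'P].
    rewrite gen_subG; apply/subsetP=> x.
    by rewrite inE => xs; apply/astab1P/fix_p.
  by move/products_sub/(subsetP subC)/astab1P.
apply: allpairs_uniq => //; first exact: map_uniq uniq_tp.
move=> [? ?] [? ?] /allpairsP[[g h] /= [gs ht [-> ->]]].
move=> /allpairsP[[g' h'] /= [gs' ht' [-> ->]]] /= eq_gh.
suff eq_h : h = h' by move: eq_gh; rewrite eq_h => /mulIg->.
apply: (uniq_map_inj uniq_tp) => //.
have:= congr1 (fun g : {perm T} => g p) eq_gh.
by rewrite !permM (fix_s _ gs) (fix_s _ gs').
Qed.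

(** * Computing with permutations as lists of values *)

(* Permutations do not compute; their lists of values do. *)
Definition images n (g : 'S_n.+1) : seq nat :=
  mkseq (fun k => g (inord k) : nat) n.+1.

Definition compose_images (u v : seq nat) : seq nat := [seq nth 0 v k | k <- u].

Lemma nth_images n (g : 'S_n.+1) k :
  k < n.+1 -> nth 0 (images g) k = g (inord k).
Proof. exact: nth_mkseq. Qed.

Lemma images_inj n : injective (@images n).
Proof.
move=> g h eq_gh; apply/permP=> k; apply: val_inj => /=.
by rewrite -[k]inord_val -!nth_images ?eq_gh.
Qed.

Lemma imagesM n (g h : 'S_n.+1) :
  images (g * h) = compose_images (images g) (images h).
Proof.
rewrite /compose_images -map_comp; apply: eq_map => k /=.
by rewrite permM nth_images // inord_val.
Qed.

Lemma images1 n : images (1 : 'S_n.+1) = iota 0 n.+1.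
Proof.
rewrite -[RHS]map_id; apply/eq_in_map => k.
by rewrite mem_iota perm1 => /inordK.
Qed.

Lemma imagesX n (g : 'S_n.+1) i :
  images (g ^+ i) = iter i (compose_images (images g)) (iota 0 n.+1).
Proof. by elim: i => [|i IHi]; rewrite ?images1 // expgS imagesM IHi. Qed.

Lemma images_tperm n i j : i < n.+1 -> j < n.+1 ->
  images (tperm (inord i : 'I_n.+1) (inord j)) =
    [seq if k == i then j else if k == j then i else k | k <- iota 0 n.+1].
Proof.
move=> lt_i lt_j; apply/eq_in_map => k; rewrite mem_iota => lt_k.
rewrite permE /= -!val_eqE /= !inordK //.
by case: (k == i); case: (k == j); rewrite inordK.
Qed.

Fixpoint products_images n (s : seq (seq nat * nat)) : seq (seq nat) :=
  if s is (u, m) :: s' then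
    [seq compose_images (iter i (compose_images u) (iota 0 n.+1)) v
       | i <- iota 0 m.+1, v <- products_images n s']
  else [:: iota 0 n.+1].

Lemma products_images_cons n u m s :
  products_images n ((u, m) :: s) =
    [seq compose_images (iter i (compose_images u) (iota 0 n.+1)) v
       | i <- iota 0 m.+1, v <- products_images n s].
Proof. by []. Qed.

Definition image_system n (s : seq ('S_n.+1 * nat)) : seq (seq nat * nat) :=
  [seq (images p.1, p.2) | p <- s].

Lemma map_images_products n (s : seq ('S_n.+1 * nat)) :
  map (@images n) (products s) = products_images n (image_system s).
Proof.
elim: s => [|[a m] s IHs]; first by rewrite /= images1.
rewrite products_cons map_allpairs /image_system map_cons.
rewrite products_images_cons -IHs allpairs_mapr.
by apply: eq_allpairs => i g; rewrite imagesM imagesX.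
Qed.

(** The hypotheses of [products_uniq] and [products_gen] in decidable form: [s] fixes the base point
    [p], the products over [t] move [p] to distinct points, and right multiplication by the
    generators stays inside the products over [s ++ t]. *)
Definition extension_check n p (s t : seq (seq nat * nat)) : bool :=
  let st := products_images n (s ++ t) in
  let pt := products_images n t in
  [&& p <= n, all (fun u => nth 0 u p == p) (unzip1 s),
      uniq [seq nth 0 u p | u <- pt]
    & all (fun u => all (fun v => compose_images u v \in st) (unzip1 (s ++ t)))
          pt].

Definition unique_products (gT : finGroupType) (s : seq (gT * nat)) : Prop :=
  uniq (products s) /\ products s =i <<[set x in unzip1 s]>>.

Lemma unique_products_nil (gT : finGroupType) :
  unique_products ([::] : seq (gT * nat)).
Proof.
split=> // g; rewrite inE /=.
suff -> : [set x in [::]] = set0 :> {set gT} by rewrite gen0 inE.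
by apply/eqP; rewrite -subset0; apply/subsetP=> x; rewrite inE.
Qed.

(** [images] is an injective translation, so the membership tests on lists hold for the permutations
    themselves. *)
Lemma unique_products_cat n p (s t : seq ('S_n.+1 * nat)) :
  extension_check n p (image_system s) (image_system t) ->
  unique_products s -> unique_products (s ++ t).
Proof.
have unzip1_images r : unzip1 (image_system r) = map (@images n) (unzip1 r).
  by rewrite /unzip1 /image_system -!map_comp.
have image_system_cat :
    image_system s ++ image_system t = image_system (s ++ t).
  by rewrite /image_system map_cat.
rewrite /extension_check image_system_cat !unzip1_images -!map_images_products.
case/and4P=> [le_pn /allP fix_p uniq_t /allP closed] [uniq_s gen_s].
split.
  apply: (products_uniq (p := inord p)) => // [g|].
    move=> /(map_f (@images n))/fix_p; rewrite nth_images // => /eqP gp.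
    by apply: val_inj; rewrite /= gp inordK.
  rewrite -(map_inj_uniq val_inj) -map_comp; move: uniq_t; rewrite -map_comp.
  by congr (uniq _); apply: eq_map => g /=; rewrite nth_images.
apply: products_gen => // g x /(map_f (@images n))/closed/allP closed_g.
move=> /(map_f (@images n))/closed_g.
by rewrite -imagesM mem_map //; apply: images_inj.
Qed.

(** * Words in the generators of M_11 and its stabiliser chain *)

Definition word (w : seq (nat * nat)) : 'S_11 :=
  \prod_(p <- w) (M11_gen1 ^+ p.1 * M11_gen2 ^+ p.2).

Lemma word_in_M11 w : word w \in M11.
Proof.
apply: group_prod => p _; rewrite groupM // groupX // mem_gen // !inE eqxx //.
by rewrite orbT.
Qed.

Lemma images_gen1 : images M11_gen1 = [:: 1; 2; 3; 4; 5; 6; 7; 8; 9; 10; 0]%N.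
Proof.
rewrite /M11_gen1 /cycle_perm /= !big_cons big_nil.
by rewrite !imagesM !images_tperm // images1.
Qed.

Lemma images_gen2 : images M11_gen2 = [:: 0; 1; 6; 9; 5; 3; 10; 2; 8; 4; 7]%N.
Proof.
rewrite /M11_gen2 /cycle_perm !big_cons !big_nil.
by rewrite !imagesM !images_tperm // images1.
Qed.

(** The literal lists are those of [images_gen1] and [images_gen2], so evaluation never meets a
    permutation. *)
Definition word_images (w : seq (nat * nat)) : seq nat :=
  foldr (fun p => compose_images
    (compose_images
       (iter p.1 (compose_images [:: 1; 2; 3; 4; 5; 6; 7; 8; 9; 10; 0]%N)
          (iota 0 11))
       (iter p.2 (compose_images [:: 0; 1; 6; 9; 5; 3; 10; 2; 8; 4; 7]%N)
          (iota 0 11))))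
    (iota 0 11) w.

Lemma images_word w : images (word w) = word_images w.
Proof.
rewrite /word; elim: w => [|p w IHw]; first by rewrite big_nil images1.
by rewrite big_cons !imagesM IHw !imagesX images_gen1 images_gen2.
Qed.

(** The first element is [M11_gen2], of order 4; the second has the same square, so exponents 0 and
    1 suffice for it. *)
Definition Q8_system : seq ('S_11 * nat) :=
  [:: (word [:: (0, 1)]%N, 3%N); (word [:: (1, 1); (9, 2); (9, 0)]%N, 1%N)].

(** Two commuting elements of order 3, generating a group 3^2 regular on the points other than 0 and
    1. *)
Definition E9_system : seq ('S_11 * nat) :=
  [:: (word [:: (1, 1); (5, 1); (1, 3)]%N, 2%N);
      (word [:: (1, 2); (4, 3); (7, 3)]%N, 2%N)].

(* The first element merges the two orbits of length 5 of the second one on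
   the points other than 0. *)
Definition M10_system : seq ('S_11 * nat) :=
  [:: (word [:: (1, 1); (10, 2)]%N, 1%N); (word [:: (1, 1); (10, 1)]%N, 4%N)].

Definition C11_system : seq ('S_11 * nat) := [:: (word [:: (1, 0)]%N, 10)].

Definition M11_system :=
  ((Q8_system ++ E9_system) ++ M10_system) ++ C11_system.

Ltac check_extension :=
  rewrite /M11_system /Q8_system /E9_system /M10_system /C11_system
    /image_system /= !images_word; vm_compute; reflexivity.

Lemma M11_unique_products : unique_products M11_system.
Proof.
(* Each application strips the last block, so the base points come from the top of the chain down:
   0, 1, 8, 2. *)
apply: (@unique_products_cat 10 0); first by check_extension.
apply: (@unique_products_cat 10 1); first by check_extension.
apply: (@unique_products_cat 10 8); first by check_extension.
apply: (@unique_products_cat 10 2 [::]); first by check_extension.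
exact: unique_products_nil.
Qed.

Theorem theorem3 : has_ordered_generating_system M11.
Proof.
have [uniq_s gen_s] := M11_unique_products.
have sub_M11 : {subset unzip1 M11_system <= M11}.
  by apply/allP; rewrite /= !word_in_M11.
apply: (products_ogs uniq_s sub_M11) => g; rewrite gen_s.
suff -> : <<[set x in unzip1 M11_system]>> = M11 :> {set _} by [].
apply/eqP; rewrite eqEsubset !gen_subG; apply/andP; split.
  by apply/subsetP=> x; rewrite inE; apply: sub_M11.
(* Both generators of [M11] occur in the system: [M11_gen1] is its last element and [M11_gen2] its
   first. *)
have gen1E : word [:: (1, 0)]%N = M11_gen1.
  by rewrite /word big_seq1 expg1 mulg1.
have gen2E : word [:: (0, 1)]%N = M11_gen2.
  by rewrite /word big_seq1 expg1 mul1g.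
apply/subsetP=> x; rewrite !inE => /orP[] /eqP ->; apply: mem_gen.
  by rewrite -gen1E !inE eqxx !orbT.
by rewrite -gen2E !inE eqxx.
Qed.
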